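(* Let $G\le\mathrm{Sym}(\Omega)$ be a primitive solvable permutation group and $\mathcal X=\mathrm{Inv}(G)$. Then $\mathcal X$ has a (possibly equal to $\mathcal X$) fusion isomorphic to $\mathcal Y\uparrow L$, where $\mathcal Y$ is a linearly primitive scheme and $L$ is a transitive permutation group. Moreover, if $\mathcal X$ is antisymmetric, then $\mathcal Y$ is antisymmetric and $L$ has odd order.
   Context: A coherent configuration on a finite set $\Omega$ is $\mathcal X=(\Omega,S)$ with $S$ a partition of $\Omega\times\Omega$ such that $1_\Omega$ is a union of elements of $S$, $s^*=\{(\beta,\alpha):(\alpha,\beta)\in s\}\in S$ for $s\in S$, and for $r,s,t\in S$ the number $|\{\gamma:(\alpha,\gamma)\in r,(\gamma,\beta)\in s\}|$ is independent of $(\alpha,\beta)\in t$; it is a scheme if $1_\Omega\in S$, antisymmetric if every $s\in S$ with $s=s^*$ lies in $1_\Omega$. $\mathcal X'$ is a fusion of $\mathcal X$ if every union of elements of $S'$ is a union of elements of $S$. $\mathrm{Inv}(G)=(\Omega,\text{orbits of }G\text{ on }\Omega\times\Omega)$. If $G$ is a primitive solvable permutation group on $\Omega$, then $\Omega$ can be identified with a vector space $\mathbb F_p^d$ so that $G\le\mathrm{AGL}(d,p)$ contains all translations and the stabilizer $K\le \mathrm{GL}(d,p)$ of the zero vector is irreducible; the scheme $\mathrm{Inv}(G)$ is called linearly primitive if $K$ is a primitive linear group (does not permute the summands of any decomposition $\mathbb F_p^d=V_1\oplus\dots\oplus V_t$, $t>1$, of nonzero subspaces). Exponentiation: for a coherent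 configuration $\mathcal Y=(\Gamma,T)$ and $L\le\mathrm{Sym}(\{1,\dots,m\})$, for $t_1,\dots,t_m\in T$ put $t_1\otimes\dots\otimes t_m=\{(\alpha,\beta)\in\Gamma^m\times\Gamma^m:(\alpha_i,\beta_i)\in t_i\ \forall i\}$; $L$ acts on $\Gamma^m$ by permuting coordinates and hence on such relations; $\mathcal Y\uparrow L=(\Gamma^m,\{\bigcup_{l\in L}t^l: t=t_1\otimes\dots\otimes t_m,\ t_i\in T\})$, a coherent configuration. *)

(* Defs.v *)
From HB Require Import structures.
From mathcomp Require Import all_boot all_order all_algebra all_fingroup all_solvable.
Set Implicit Arguments. Unset Strict Implicit. Unset Printing Implicit Defensive.
Import GRing.Theory.

Section CC.
Variable T : finType.
Implicit Types (S : {set {set T * T}}) (s : {set T * T}).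

Definition diag_rel : {set T * T} := [set x | x.1 == x.2].
Definition rel_transp s : {set T * T} := [set x | (x.2, x.1) \in s].

Definition inter_num (r s : {set T * T}) (a b : T) : nat :=
  #|[set g : T | ((a, g) \in r) && ((g, b) \in s)]|.

Definition is_cc S : Prop :=
  [/\ partition S [set: T * T],
      exists2 U : {set {set T * T}}, U \subset S & cover U = diag_rel,
      forall s, s \in S -> rel_transp s \in S &
      forall r s t, r \in S -> s \in S -> t \in S ->
        forall x y, x \in t -> y \in t -> inter_num r s x.1 x.2 = inter_num r s y.1 y.2].

Definition is_scheme S : Prop := is_cc S /\ diag_rel \in S.

Definition cc_antisymmetric S : Prop :=
  is_cc S /\ forall s, s \in S -> rel_transp s = s -> s \subset diag_rel.

Definition fusion (S' S : {set {set T * T}}) : Prop :=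
  [/\ is_cc S', is_cc S &
      forall s', s' \in S' -> exists2 U : {set {set T * T}}, U \subset S & cover U = s'].

Definition Inv (G : {set {perm T}}) : {set {set T * T}} :=
  [set [set (g x.1, g x.2) | g : {perm T} in G] | x in [set: T * T]].
End CC.

Definition cc_iso (T T' : finType) (S : {set {set T * T}}) (S' : {set {set T' * T'}}) : Prop :=
  exists f : T -> T', bijective f /\
    S' = [set [set (f x.1, f x.2) | x in s] | s : {set T * T} in S].

Section Expo.
Variables (G : finType) (m : nat).
Definition coord_act (l : {perm 'I_m}) (a : {ffun 'I_m -> G}) : {ffun 'I_m -> G} :=
  [ffun i => a ((l^-1)%g i)].
Definition tensor_rel (t : {ffun 'I_m -> {set G * G}}) : {set {ffun 'I_m -> G} * {ffun 'I_m -> G}} :=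
  [set x : {ffun 'I_m -> G} * {ffun 'I_m -> G} | [forall i, (x.1 i, x.2 i) \in t i]].
Definition rel_act (l : {perm 'I_m}) (r : {set {ffun 'I_m -> G} * {ffun 'I_m -> G}}) :=
  [set (coord_act l x.1, coord_act l x.2) | x : {ffun 'I_m -> G} * {ffun 'I_m -> G} in r].
Definition expo (Y : {set {set G * G}}) (L : {set {perm 'I_m}})
  : {set {set {ffun 'I_m -> G} * {ffun 'I_m -> G}}} :=
  [set \bigcup_(l in L) rel_act l (tensor_rel t)
     | t in [set t : {ffun 'I_m -> {set G * G}} | [forall i, t i \in Y]]].
End Expo.

Section Linear.
Local Open Scope ring_scope.
Variables (p n : nat).
Local Notation V := 'rV['F_p]_n.+1.

Definition lin_irreducible (K : {set {'GL_n.+1['F_p]}}) : Prop :=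
  forall U : 'M['F_p]_n.+1,
    (forall A, A \in K -> (U *m GLval A <= U)%MS) -> U == 0 \/ row_full U.

Definition lin_primitive (K : {set {'GL_n.+1['F_p]}}) : Prop :=
  ~ exists t (Vs : 'I_t -> 'M['F_p]_n.+1),
      [/\ (1 < t)%N, forall i, Vs i != 0,
          mxdirect (\sum_i Vs i)%MS, row_full (\sum_i Vs i)%MS &
          forall A, A \in K -> forall i, exists j, (Vs i *m GLval A == Vs j)%MS].

(* Inv of the affine group V : K = {v |-> v A + b | A in K, b in V}. *)
Definition affine_Inv (K : {set {'GL_n.+1['F_p]}}) : {set {set V * V}} :=
  [set [set (x.1 *m GLval A + b, x.2 *m GLval A + b) | A in K, b in [set: V]]
     | x in [set: V * V]].
End Linear.

(* A linearly primitive scheme: (isomorphic to) Inv(G) for G = V : K a primitive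
   solvable affine group (K irreducible, solvable) with K a primitive linear group. *)
Definition lin_prim_scheme (Gam : finType) (Y : {set {set Gam * Gam}}) : Prop :=
  is_scheme Y /\
  exists (p n : nat) (K : {group {'GL_n.+1['F_p]}}),
    [/\ prime p, solvable K, lin_irreducible K, lin_primitive K &
        cc_iso (affine_Inv K) Y].

(* Main.v *)
Require Import Defs.
From mathcomp Require Import all_boot all_order all_algebra all_fingroup all_solvable.
From mathcomp Require Import all_character.
Set Implicit Arguments. Unset Strict Implicit. Unset Printing Implicit Defensive.
Import GRing.Theory.

(** A minimal normal subgroup of [G] is elementary abelian and regular, so it
identifies the points with the vectors of some [F_p^d], on which [G] acts by
affine maps whose linear parts form an irreducible group [K].  Take a
decomposition of [F_p^d] into a maximal number [m] of summands permuted by [K].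
By irreducibility [K] permutes them transitively, and by maximality the group
[K1] that the stabilizer of a summand induces on it is a primitive linear group.
Moving a basis of one summand to the others by elements of [K] gives coordinates
in which [G] lies in the wreath product of the affine group of [K1] by the group
[L] of permutations of the summands, in product action.  The orbitals of this
wreath product are the relations of the exponentiation by [L] of the scheme of
the affine group, hence the fusion.  Finally, [Inv G] is antisymmetric iff no
element of [G] swaps two points, which forces [G], and with it [p], [K1] and
[L], to be odd. *)

(** * Orbitals of a permutation group: coherence, fusion and antisymmetry *)

Section Orbitals.
Local Open Scope group_scope.
Variable T : finType.
Implicit Types (G W : {group {perm T}}) (x y : T * T).

Definition orbital (G : {set {perm T}}) x : {set T * T} :=
  [set (g x.1, g x.2) | g : {perm T} in G].

Lemma orbitalP (G : {set {perm T}}) x y :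
  reflect (exists2 g : {perm T}, g \in G & y = (g x.1, g x.2)) (y \in orbital G x).
Proof. exact: imsetP. Qed.

Lemma orbital_refl G x : x \in orbital G x.
Proof. by apply/orbitalP; exists 1; rewrite ?group1 // !perm1; case: x. Qed.

Lemma orbital_eqP G x y : reflect (orbital G x = orbital G y) (x \in orbital G y).
Proof.
apply: (iffP idP) => [/orbitalP[g Gg ->]|<-]; last exact: orbital_refl.
apply/setP=> z; apply/orbitalP/orbitalP => [] [h Gh ->] /=.
  by exists (g * h); rewrite ?groupM // !permM.
by exists (g^-1 * h); rewrite ?groupM ?groupV // !permM !permK.
Qed.

Lemma InvP (G : {set {perm T}}) s :
  reflect (exists x, s = orbital G x) (s \in Inv G).
Proof. by apply: (iffP imsetP) => [[x _ ->]|[x ->]]; exists x. Qed.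

Lemma orbital_Inv (G : {set {perm T}}) x : orbital G x \in Inv G.
Proof. by apply/InvP; exists x. Qed.

Lemma orbital_transp (G : {set {perm T}}) x :
  rel_transp (orbital G x) = orbital G (x.2, x.1).
Proof.
apply/setP=> y; rewrite inE; apply/orbitalP/orbitalP=> [] [g Gg e]; exists g => //.
  by case: y e => u v [-> ->].
by rewrite e.
Qed.

Lemma is_cc_Inv G : is_cc (Inv G).
Proof.
split.
- apply/and3P; split.
  + apply/eqP/setP=> x; rewrite inE; apply/bigcupP.
    by exists (orbital G x); rewrite ?orbital_Inv ?orbital_refl.
  + apply/trivIsetP=> _ _ /InvP[x ->] /InvP[y ->] /eqP nexy.
    rewrite -setI_eq0; apply/eqP/setP=> z; rewrite !inE.
    apply/andP=> [[/orbital_eqP zx /orbital_eqP zy]].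
    by apply: nexy; rewrite -zx.
  + apply/negP=> /InvP[x e]; have := orbital_refl G x.
    by rewrite -e inE.
- exists [set orbital G (a, a) | a : T].
    by apply/subsetP=> _ /imsetP[a _ ->]; apply: orbital_Inv.
  apply/setP=> x; rewrite inE; apply/bigcupP/eqP.
    by case=> _ /imsetP[a _ ->] /orbitalP[g _ ->].
  case: x => u v /= <-; exists (orbital G (u, u)); last exact: orbital_refl.
  exact: imset_f.
- by move=> _ /InvP[x ->]; rewrite orbital_transp orbital_Inv.
- move=> _ _ _ /InvP[r ->] /InvP[s ->] /InvP[t ->] x y.
  move=> /orbital_eqP <- /orbitalP[g Gg ->] /=.
  (* The points counted for [x] are carried by [g] bijectively onto those counted for its image. *)
  rewrite /inter_num -[LHS](card_imset _ (@perm_inj _ g)).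
  apply: eq_card => z; rewrite !inE.
  have orbG u v w : ((g u, g v) \in orbital G w) = ((u, v) \in orbital G w).
    apply/orbital_eqP/orbital_eqP=> <-; [symmetry|]; apply/orbital_eqP.
      by apply/orbitalP; exists g.
    by apply/orbitalP; exists g.
  rewrite -[z](permKV g) mem_imset ?inE ?orbG //; exact: perm_inj.
Qed.

Lemma fusion_Inv G W : G \subset W -> fusion (Inv W) (Inv G).
Proof.
move=> sGW; split; try exact: is_cc_Inv.
move=> _ /InvP[x ->]; exists [set orbital G y | y in orbital W x].
  by apply/subsetP=> _ /imsetP[y _ ->]; apply: orbital_Inv.
apply/setP=> z; apply/bigcupP/idP=> [[_ /imsetP[y Wy ->]]|Wz].
  move=> /orbitalP[g Gg ->]; move/orbital_eqP: Wy => <-.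
  by apply/orbitalP; exists g; rewrite ?(subsetP sGW).
by exists (orbital G z); rewrite ?orbital_refl ?imset_f.
Qed.

Lemma is_scheme_Inv G : [transitive G, on [set: T] | 'P] -> is_scheme (Inv G).
Proof.
case/imsetP=> a _ aG; split; first exact: is_cc_Inv.
apply/InvP; exists (a, a); apply/setP=> x; rewrite inE; apply/eqP/orbitalP.
  case: x => u v /= <-; have: u \in orbit 'P G a by rewrite -aG inE.
  by case/orbitP=> g Gg <-; exists g.
by case=> g _ ->.
Qed.

Definition no_swap (G : {set {perm T}}) :=
  forall g a, g \in G -> g (g a) = a -> g a = a.

(** The orbital of a pair is its own transpose exactly when some element of [G] interchanges the two
    points. *)
Lemma antisymmetric_InvP G : cc_antisymmetric (Inv G) <-> no_swap G.
Proof.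
split=> [[_ anti] g a Gg gga|noG].
  have /subsetP/(_ _ (orbital_refl _ _)) : orbital G (g a, a) \subset diag_rel T.
    apply: anti (orbital_Inv _ _) _; rewrite orbital_transp; apply/orbital_eqP.
    by apply/orbitalP; exists g; rewrite //= gga.
  by rewrite inE => /eqP.
split=> [|_ /InvP[[a b] ->]]; first exact: is_cc_Inv.
rewrite orbital_transp => /orbital_eqP/orbitalP[g Gg /= [eb ea]].
have gb: g b = b by apply: noG; rewrite // -ea -eb.
have ab : a = b by rewrite ea.
by apply/subsetP=> _ /orbitalP[h _ ->]; rewrite inE /= ab.
Qed.

(** By Cauchy, a group of even order has an involution, which swaps any point that it moves with its
    image. *)
Lemma no_swap_odd G : no_swap G -> odd #|G|.
Proof.
move=> noG; apply: contraT; rewrite -dvdn2 => /(Cauchy (isT : prime 2))[g Gg og].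
have g1 : g = 1.
  apply/permP=> a; rewrite perm1; apply: noG => //.
  by rewrite -permM -expg2 -og expg_order perm1.
by move: og; rewrite g1 order1.
Qed.

End Orbitals.

(** * Wreath products in product action, and their orbitals *)

Section Wreath.
Local Open Scope group_scope.
Variables (T Gam : finType) (m : nat).
Variables (H : {group {perm Gam}}) (L : {group {perm 'I_m}}).
Variables (f : T -> {ffun 'I_m -> Gam}) (fi : {ffun 'I_m -> Gam} -> T).
Hypotheses (fK : cancel f fi) (fiK : cancel fi f).

(** The product action is carried over to [T] by the bijection [f]: coordinates are permuted by [l],
    then coordinate [i] is moved by [h i]. *)
Definition wreath_elt (g : {perm T}) : Prop :=
  exists2 l : {perm 'I_m}, l \in L & exists2 h : 'I_m -> {perm Gam}, forall i, h i \in H &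
    forall t i, f (g t) i = h i (f t (l^-1 i)).

Definition wreath_set : {set {perm T}} :=
  [set g : {perm T} | [exists l in L, [exists h : {ffun 'I_m -> {perm Gam}},
     [forall i, h i \in H] &&
     [forall t, forall i, f (g t) i == h i (f t (l^-1 i))]]]].

Lemma wreathP g : reflect (wreath_elt g) (g \in wreath_set).
Proof.
rewrite inE; apply: (iffP exists_inP) => [[l Ll]|[l Ll [h Hh gE]]].
  case/existsP=> h /andP[/forallP Hh /forallP gE]; exists l => //.
  by exists h => // t i; apply/eqP; have /forallP := gE t.
exists l => //; apply/existsP; exists (finfun h); apply/andP; split.
  by apply/forallP=> i; rewrite ffunE.
by apply/forallP=> t; apply/forallP=> i; rewrite ffunE gE.
Qed.

Fact wreath_group_set : group_set wreath_set.
Proof.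
apply/group_setP; split.
  apply/wreathP; exists 1; first exact: group1.
  exists (fun=> 1) => [i|t i]; first exact: group1.
  by rewrite invg1 !perm1.
move=> g g' /wreathP[l Ll [h Hh gE]] /wreathP[l' Ll' [h' Hh' gE']].
apply/wreathP; exists (l * l'); first exact: groupM.
exists (fun i => h (l'^-1 i) * h' i) => [i|t i]; first exact: groupM.
by rewrite invMg !permM gE' gE.
Qed.
Definition wreath : {group {perm T}} := Group wreath_group_set.

Lemma wreath_perm l (h : 'I_m -> {perm Gam}) :
    l \in L -> (forall i, h i \in H) ->
  exists2 g, g \in wreath & forall t i, f (g t) i = h i (f t (l^-1 i)).
Proof.
move=> Ll Hh; pose F t := fi [ffun i => h i (f t (l^-1 i))].
have injF : injective F.
  move=> t u /(can_inj fiK)/ffunP e; apply: (can_inj fK); apply/ffunP=> i.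
  by have := e (l i); rewrite !ffunE permK => /perm_inj.
have FE t i : f (perm injF t) i = h i (f t (l^-1 i)) by rewrite permE fiK ffunE.
by exists (perm injF) => //; apply/wreathP; exists l => //; exists h.
Qed.

(** The components [h i] vary in [H] independently of each other, so for a fixed [l] the images of
    [x] fill the whole tensor product of the orbitals of its coordinates, moved by [l]. *)
Lemma image_orbital_wreath (x : T * T) (t : {ffun 'I_m -> {set Gam * Gam}}) :
    (forall i, t i = orbital H (f x.1 i, f x.2 i)) ->
  [set (f y.1, f y.2) | y in orbital wreath x]
    = \bigcup_(l in L) rel_act l (tensor_rel t).
Proof.
move=> tE; apply/setP=> z; apply/imsetP/bigcupP.
  case=> _ /orbitalP[g /wreathP[l Ll [h Hh gE]] ->] ->{z}.
  exists l => //=; apply/imsetP.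
  (* Here [h] acts before the coordinates move, so its index is shifted by [l]; [coord_act l] shifts
     it back. *)
  exists ([ffun i => h (l i) (f x.1 i)], [ffun i => h (l i) (f x.2 i)]).
    rewrite inE; apply/forallP=> i; rewrite !ffunE tE.
    by apply/orbitalP; exists (h (l i)).
  by congr pair; apply/ffunP=> i; rewrite !ffunE permKV gE.
case=> l Ll /imsetP[[u v]]; rewrite inE => /forallP /= uv ->{z}.
have /fin_all_exists[h hE] i : exists k : {perm Gam},
    k \in H /\ (u i, v i) = (k (f x.1 i), k (f x.2 i)).
  by have := uv i; rewrite tE => /orbitalP[k]; exists k.
have [i|g Wg gE] := wreath_perm (h := fun i => h (l^-1 i)) Ll.
  by case: (hE (l^-1 i)).
exists (g x.1, g x.2); first by apply/orbitalP; exists g.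
by congr pair; apply/ffunP=> i; rewrite !ffunE /= gE; case: (hE (l^-1 i)) => _ [eu ev]; rewrite ?eu ?ev.
Qed.

Lemma cc_iso_wreath : cc_iso (Inv wreath) (expo (Inv H) L).
Proof.
exists f; split; first by exists fi.
apply/setP=> s; apply/imsetP/imsetP.
  case=> t; rewrite inE => /forallP tH ->{s}.
  have /fin_all_exists[x xE] i := InvP _ _ (tH i).
  pose y := (fi [ffun i => (x i).1], fi [ffun i => (x i).2]).
  exists (orbital wreath y); first exact: orbital_Inv.
  symmetry; apply: image_orbital_wreath => i.
  by rewrite !fiK !ffunE xE; case: (x i).
case=> _ /InvP[x ->] ->{s}.
exists [ffun i => orbital H (f x.1 i, f x.2 i)].
  by rewrite inE; apply/forallP=> i; rewrite ffunE orbital_Inv.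
by apply: image_orbital_wreath => i; rewrite ffunE.
Qed.

End Wreath.

(** * Sections of a group given by a functional relation *)

Section FunctionalRelation.
Local Open Scope group_scope.
Variables (aT rT : finGroupType) (K : {group aT}) (H : {group rT}).
Variable R : aT -> rT -> bool.
Hypothesis R1 : R 1 1.
Hypothesis RM : forall k k' h h', k \in K -> k' \in K -> h \in H -> h' \in H ->
  R k h -> R k' h' -> R (k * k') (h * h').
Hypothesis Rfun : forall k h h', h \in H -> h' \in H -> R k h -> R k h' -> h = h'.
Hypothesis Rtotal : forall h, h \in H -> exists2 k, k \in K & R k h.

(** The relation is the graph of a morphism from a subgroup [D] of [K] onto [H]. This serves both
    for the permutations of the blocks and for the group induced on one block by its stabilizer. *)
Lemma section_of_relation : #|H| %| #|K| /\ (solvable K -> solvable H).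
Proof.
pose D := [set k in K | [exists h in H, R k h]].
have gD : group_set D.
  apply/group_setP; split.
    by rewrite inE group1; apply/exists_inP; exists 1.
  move=> k k'; rewrite !inE => /andP[Kk /exists_inP[h Hh Rh]].
  case/andP=> Kk' /exists_inP[h' Hh' Rh']; rewrite groupM //=.
  by apply/exists_inP; exists (h * h'); rewrite ?groupM ?RM.
(* The default [1] is taken only outside [D]. *)
pose phi k := odflt 1 [pick h in H | R k h].
have phiP k : k \in D -> phi k \in H /\ R k (phi k).
  rewrite inE => /andP[_ /exists_inP[h Hh Rh]]; rewrite /phi.
  by case: pickP => [h' /andP[]|/(_ h)]; rewrite ?Hh ?Rh.
have phiM : {in group gD &, {morph phi : k k' / k * k'}}.
  move=> k k' Dk Dk' /=.
  have [Hk Rk] := phiP _ Dk; have [Hk' Rk'] := phiP _ Dk'.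
  have [|Hkk Rkk] := phiP (k * k'); first exact: (@groupM _ (group gD)).
  move: Dk Dk'; rewrite !inE => /andP[Kk _] /andP[Kk' _].
  by apply: Rfun Rkk (RM _ _ _ _ Rk Rk'); rewrite ?groupM.
have sDK : group gD \subset K by apply/subsetP=> k; rewrite inE => /andP[].
have im : Morphism phiM @* group gD = H.
  apply/setP=> h; apply/morphimP/idP => [[k _ /phiP[Hk _] ->] //|Hh].
  have [k Kk Rkh] := Rtotal Hh.
  have Dk : k \in D by rewrite inE Kk; apply/exists_inP; exists h.
  exists k => //=; have [Hk Rk] := phiP _ Dk.
  exact: Rfun Rk.
split; first by rewrite -im (dvdn_trans (dvdn_morphim _ _)) // cardSg.
by move=> solK; rewrite -im morphim_sol // (solvableS sDK).
Qed.

End FunctionalRelation.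

(** * Primitive solvable groups as affine groups *)

Lemma abelian_trans_regular (T : finType) (N : {group {perm T}}) (a : T)
    (x y : {perm T}) :
    abelian N -> [transitive N, on [set: T] | 'P] -> x \in N -> y \in N ->
  x a = y a -> x = y.
Proof.
move=> cNN trN Nx Ny xya; apply/permP=> t.
have: t \in orbit 'P N a by rewrite (atransP trN) ?inE.
case/orbitP=> z Nz <-; rewrite /= /aperm -!permM.
by rewrite !(centsP cNN z) // !permM xya.
Qed.

(** A minimal normal subgroup [N] is regular, so [psi] identifies a vector with the image of a base
    point [a] under the corresponding element of [N]. The linear group [K] is the image of [G]
    acting on [N] by conjugation, irreducible because [N] is minimal. *)
Lemma affine_of_primitive (T : finType) (G : {group {perm T}}) :
    1 < #|T| -> [primitive G, on [set: T] | 'P] -> solvable G ->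
  exists p d (K : {group {'GL_d.+1['F_p]}}) (phi : T -> 'rV['F_p]_d.+1),
    [/\ prime p, p %| #|G|, #|K| %| #|G|, solvable K & lin_irreducible K] /\
    (bijective phi /\ forall g, g \in G ->
      exists2 A, A \in K & exists b, forall t,
        phi (g t) = (phi t *m GLval A + b)%R).
Proof.
move=> T1 primG solG; have /andP[trG _] := primG.
have ntG : G :!=: 1%g.
  apply: contraTneq T1 => G1; rewrite -leqNgt -cardsT.
  by rewrite (leq_trans (dvdn_leq _ (atrans_dvd trG))) ?G1 ?cards1.
have [N minN sNG] := minnormal_exists ntG (normG G).
have [nNG ntN /is_abelemP[p p_pr abelN]] := minnormal_solvable minN sNG solG.
have trN : [transitive N, on [set: T] | 'P].
  (* A normal subgroup of a primitive group is transitive or fixes every point; the latter would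
     make [N] trivial. *)
  have [|sNC|//] := prim_trans_norm (H := N) primG; first exact/andP.
  by case/eqP: ntN; apply/trivgP; apply: subset_trans sNC (aperm_faithful _).
have cNN := abelem_abelian abelN.
have [a _] : exists a : T, a \in predT by apply/card_gt0P/ltnW.
have regN := abelian_trans_regular (a := a) cNN trN.
have orbN t : exists2 x, x \in N & x a = t.
  have: t \in orbit 'P N a by rewrite (atransP trN) ?inE.
  by case/orbitP=> x; exists x.
pose rG := abelem_repr abelN ntN nNG.
pose psi v : T := rVabelem abelN ntN v a.
have psi_inj : injective psi.
  by move=> u v /regN e; apply: rVabelem_inj (e _ _); apply: mem_rVabelem.
have /fin_all_exists[phi phiK] t : exists v, psi v = t.
  have [x Nx <-] := orbN t; exists (abelem_rV abelN ntN x).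
  by rewrite /psi abelem_rV_K.
exists p, (abelem_dim' N), (reprGLm rG @* G)%G, phi; split; [split=> //|split].
- have [_ pN _] := pgroup_pdiv (abelem_pgroup abelN) ntN.
  exact: dvdn_trans pN (cardSg sNG).
- exact: dvdn_morphim.
- exact: morphim_sol.
- move=> U stU; have /mx_irrP[_ irr] := abelem_mx_irrP abelN ntN nNG minN.
  have [->|U0] := eqVneq U 0%R; [by left | right].
  apply: irr => //; apply/mxmoduleP=> x Gx.
  by rewrite -(comp_reprGLm rG Gx) /=; apply: stU; rewrite mem_morphim.
- by exists psi => // v; apply: psi_inj; rewrite phiK.
move=> g Gg; have [x Nx xa] := orbN (g a).
(* This element fixes [a], so it moves [y a] to [(y ^ k) a] and is linear in the coordinates; the
   remaining factor [x] is a translation. *)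
have Gk : (g * x^-1)%g \in G by rewrite groupM // groupV (subsetP sNG).
exists (reprGLm rG (g * x^-1)%g); first by rewrite mem_morphim.
exists (abelem_rV abelN ntN x) => t; apply: psi_inj; rewrite phiK.
rewrite -{1}[t]phiK /psi rVabelemD (abelem_rV_K _ _ Nx).
rewrite -/(comp GLval (reprGLm rG) _) comp_reprGLm // rVabelemJ //.
set y := rVabelem _ _ _; set k := (g * _)%g in Gk *.
have -> : g = (k * x)%g by rewrite mulgKV.
have ka : (k^-1)%g a = a by rewrite invMg invgK permM xa permK.
by rewrite conjgE !permM ka.
Qed.

(** * Decompositions into blocks permuted by a linear group *)

Lemma mxrank_sums_leq (F : fieldType) (I : finType) (P : pred I) (n : nat)
    (A : I -> 'M[F]_n) :
  \rank (\sum_(i | P i) A i)%MS <= \sum_(i | P i) \rank (A i).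
Proof.
elim/big_rec2: _ => [|i r M _ le_rM]; first by rewrite mxrank0.
by rewrite (leq_trans (mxrank_adds_leqif _ _)) // leq_add2l.
Qed.

Lemma GLval_free (p d : nat) (A : {'GL_d.+1['F_p]}) : row_free (GLval A).
Proof. by rewrite row_free_unit; exact (GL_unitmx A). Qed.

Lemma GLvalM (p d : nat) (A A' : {'GL_d.+1['F_p]}) :
  GLval (A * A')%g = (GLval A *m GLval A')%R :> 'M['F_p]_d.+1.
Proof. exact (GL_MxE A A'). Qed.

Section Blocks.
Local Open Scope ring_scope.
Variables (p d : nat) (K : {group {'GL_d.+1['F_p]}}).
Local Notation V := 'M['F_p]_d.+1.

(* The rank equation says that the (full) sum is direct. *)
Definition block_system (I : finType) (Vs : I -> V) : bool :=
  [&& [forall i, Vs i != 0], (\sum_i \rank (Vs i) == d.+1)%N,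
      row_full (\sum_i Vs i)%MS &
      [forall A in K, forall i, exists j, (Vs i *m GLval A == Vs j)%MS]].

Lemma block_systemP (I : finType) (Vs : I -> V) :
  reflect [/\ forall i, Vs i != 0, (\sum_i \rank (Vs i) = d.+1)%N,
              row_full (\sum_i Vs i)%MS &
              forall A, A \in K -> forall i, exists j, (Vs i *m GLval A == Vs j)%MS]
          (block_system Vs).
Proof.
apply: (iffP and4P) => [[/forallP V0 /eqP rV fV st]|[V0 rV fV st]]; split=> //.
- by move=> A KA i; have /forall_inP/(_ A KA)/forallP/(_ i)/existsP := st.
- exact/forallP.
- exact/eqP.
apply/forall_inP=> A KA; apply/forallP=> i; apply/existsP; exact: st.
Qed.

Lemma block_system_reindex (I J : finType) (f : J -> I) (Vs : I -> V) (Ws : J -> V) :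
    bijective f -> (forall j, Ws j = Vs (f j)) ->
  block_system Vs -> block_system Ws.
Proof.
move=> bijf WE /block_systemP[V0 rV fV st]; have [g fK gK] := bijf.
apply/block_systemP; split=> [j|||A KA j].
- by rewrite WE.
- apply: etrans rV; rewrite [RHS](reindex f) /=; last exact: onW_bij.
  by apply: eq_bigr => j _; rewrite WE.
- move: fV; rewrite (reindex f) /=; last exact: onW_bij.
  by congr row_full; apply: eq_bigr => j _; rewrite WE.
by have [i iP] := st A KA (f j); exists (g i); rewrite !WE gK.
Qed.

Lemma block_system_card (I : finType) (Vs : I -> V) :
  block_system Vs -> (#|I| <= d.+1)%N.
Proof.
case/block_systemP=> V0 rV _ _; rewrite -rV -sum1_card; apply: leq_sum => i _.
by rewrite lt0n mxrank_eq0.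
Qed.

(** The whole space is a system with one block, and the dimension bounds the number of blocks.
    Maximality is stated for all finite index types so that it applies to a refinement indexed by
    pairs. *)
Lemma max_block_system :
  exists m (Vs : 'I_m -> V), block_system Vs /\
    forall (I : finType) (Ws : I -> V), block_system Ws -> (#|I| <= m)%N.
Proof.
pose P m := [exists Vs : {ffun 'I_m -> V}, block_system Vs].
have PI (I : finType) (Ws : I -> V) : block_system Ws -> P #|I|.
  move=> bW; apply/existsP; exists [ffun i => Ws (enum_val i)].
  by apply: block_system_reindex (enum_val_bij I) _ bW => i; rewrite ffunE.
have exP : exists m, P m.
  exists #|{: 'I_1}|; apply: (PI _ (fun=> 1%:M)); apply/block_systemP; split.
  - by move=> _; rewrite -mxrank_eq0 mxrank1.
  - by rewrite big_ord1 mxrank1.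
  - by rewrite big_ord1 row_full_unit unitmx1.
  - move=> A _ i; exists i; rewrite mul1mx submx1 sub1mx row_full_unit /=.
    by rewrite -row_free_unit GLval_free.
have ubP m : P m -> (m <= d.+1)%N.
  by case/existsP=> Vs /block_system_card; rewrite card_ord.
case: (ex_maxnP exP ubP) => m /existsP[Vs bVs] maxm; exists m, Vs; split=> // I Ws bW.
exact/maxm/(PI _ Ws).
Qed.

(** * The permutation action of an irreducible group on its blocks *)

Section Coordinates.
Variables (m n : nat) (Vs : 'I_m -> V).
Hypotheses (irrK : lin_irreducible K) (sysV : block_system Vs).

Let Vs_neq0 i : Vs i != 0. Proof. by case/block_systemP: sysV. Qed.
Let Vs_rank : (\sum_i \rank (Vs i) = d.+1)%N. Proof. by case/block_systemP: sysV. Qed.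
Let Vs_full : row_full (\sum_i Vs i)%MS. Proof. by case/block_systemP: sysV. Qed.

Definition block_act i (A : {'GL_d.+1['F_p]}) j := (Vs i *m GLval A == Vs j)%MS.

Let Vs_act A i : A \in K -> exists j, block_act i A j.
Proof. by case/block_systemP: sysV => _ _ _ st KA; apply: st. Qed.

Lemma block_act1 i : block_act i 1%g i.
Proof. by rewrite /block_act mulmx1 submx_refl. Qed.

Lemma block_actM i j k A A' :
  block_act i A j -> block_act j A' k -> block_act i (A * A')%g k.
Proof.
rewrite /block_act GLvalM mulmxA => /eqmxP ij /eqmxP jk.
by apply/eqmxP; apply: eqmx_trans jk; apply: eqmxMr.
Qed.

(** The ranks of all blocks add up to the dimension, so omitting a nonzero block leaves too little
    rank to span. *)
Lemma full_subsum_blocks (J : pred 'I_m) i : row_full (\sum_(j | J j) Vs j)%MS -> J i.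
Proof.
move=> fJ; apply: contraT => nJi.
have: (\sum_j \rank (Vs j) <= \sum_(j | J j) \rank (Vs j))%N.
  by apply: leq_trans (mxrank_sums_leq J Vs); rewrite (eqP fJ) Vs_rank.
rewrite (bigID J) /= leqNgt -[X in (X < _)%N]addn0 ltn_add2l (bigD1 i) //=.
by rewrite addn_gt0 lt0n mxrank_eq0 Vs_neq0.
Qed.

Lemma block_inj i j : (Vs i == Vs j)%MS -> i = j.
Proof.
case/andP=> _ sji; apply: contraTeq isT => nij.
(* If block [j] lies in another block [i], the blocks other than [j] already span, which forces [j]
   to differ from itself. *)
suff: predC1 j j by rewrite /= eqxx.
apply: full_subsum_blocks; rewrite -sub1mx.
apply: submx_trans (_ : (\sum_i Vs i <= _)%MS); first by rewrite sub1mx.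
apply/sumsmx_subP=> k _; have [->|kj] := eqVneq k j.
  exact: (sumsmx_sup i).
exact: (sumsmx_sup k).
Qed.

Lemma block_act_fun i j k A : block_act i A j -> block_act i A k -> j = k.
Proof.
move=> /eqmxP ij /eqmxP ik; apply: block_inj; apply/eqmxP.
exact: eqmx_trans (eqmx_sym ij) ik.
Qed.

Lemma block_act_inj i j k A : block_act i A k -> block_act j A k -> i = j.
Proof.
move=> /eqmxP ik /eqmxP jk; apply: block_inj; apply/eqmxP.
have /eqmxP := eqmx_trans ik (eqmx_sym jk).
by rewrite !submxMfree ?GLval_free // => /eqmxP.
Qed.

(** The sum of the blocks reached from [i] is nonzero and invariant under [K], hence the whole
    space, so no block is left out. *)
Lemma block_act_trans i j : exists2 A, A \in K & block_act i A j.
Proof.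
pose J := [pred j | [exists A in K, block_act i A j]].
apply/exists_inP; rewrite -[[exists A in K, _]]/(J j).
apply: full_subsum_blocks.
have [|/eqP S0|//] := irrK (U := (\sum_(j | J j) Vs j)%MS).
  move=> A KA; rewrite sumsmxMr; apply/sumsmx_subP=> k /exists_inP[A' KA' ik].
  have [l kl] := Vs_act k KA; apply: (sumsmx_sup l); last by case/andP: kl.
  apply/exists_inP; exists (A' * A)%g; first exact: groupM.
  exact: block_actM kl.
have: (Vs i <= \sum_(j | J j) Vs j)%MS.
  apply: (sumsmx_sup i) => //; apply/exists_inP; exists 1%g; rewrite ?group1 //.
  exact: block_act1.
by rewrite S0 submx0 (negPf (Vs_neq0 i)).
Qed.

Definition block_perms : {set {perm 'I_m}} :=
  [set s : {perm 'I_m} | [exists A in K, [forall i, block_act i A (s i)]]].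

Fact block_perms_group_set : group_set block_perms.
Proof.
apply/group_setP; split.
  rewrite inE; apply/exists_inP; exists 1%g; rewrite ?group1 //.
  by apply/forallP=> i; rewrite perm1 block_act1.
move=> s s'; rewrite !inE => /exists_inP[A KA /forallP sA].
case/exists_inP=> A' KA' /forallP sA'; apply/exists_inP.
exists (A * A')%g; first exact: groupM.
by apply/forallP=> i; rewrite permM (block_actM (sA i)).
Qed.
Definition block_perm_group := Group block_perms_group_set.

Lemma block_permP A :
  A \in K -> exists2 s, s \in block_perm_group & forall i, block_act i A (s i).
Proof.
move=> KA; have /fin_all_exists[s sE] i := Vs_act i KA.
have s_inj : injective s.
  by move=> i j eij; apply: block_act_inj (sE i) _; rewrite eij.
exists (perm s_inj) => [|i]; last by rewrite permE.
rewrite inE; apply/exists_inP; exists A => //.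
by apply/forallP=> i; rewrite permE.
Qed.

Lemma block_perms_trans : [transitive block_perm_group, on [set: 'I_m] | 'P].
Proof.
have i0 : 'I_m.
  case: m Vs Vs_rank => [|m'] Vs' rV; last exact: ord0.
  by move: rV; rewrite big_ord0.
apply/imsetP; exists i0 => //; apply/setP=> j; rewrite inE; symmetry.
have [A KA ij] := block_act_trans i0 j; have [s Ls sA] := block_permP KA.
apply/orbitP; exists s => //=; exact: block_act_fun (sA i0) ij.
Qed.

Lemma block_perms_card : (#|block_perm_group| %| #|K|)%N.
Proof.
have [] // := @section_of_relation _ _ K block_perm_group
  (fun A (s : {perm 'I_m}) => [forall i, block_act i A (s i)]).
- by apply/forallP=> i; rewrite perm1 block_act1.
- move=> A A' s s' _ _ _ _ /forallP sA /forallP sA'.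
  by apply/forallP=> i; rewrite permM (block_actM (sA i)).
- move=> A s s' _ _ /forallP sA /forallP sA'; apply/permP=> i.
  exact: block_act_fun (sA i) (sA' i).
- by move=> s; rewrite inE => /exists_inP.
Qed.

(** * Transported bases and the group induced on one block *)

Variables (B1 : 'M['F_p]_(n.+1, d.+1)) (g : 'I_m -> {'GL_d.+1['F_p]}).
Hypotheses (B1free : row_free B1) (Kg : forall i, g i \in K).
Hypothesis B1g : forall i, (B1 *m GLval (g i) == Vs i)%MS.

Definition block_base i := B1 *m GLval (g i).
Local Notation B := block_base.

Lemma block_base_free i : row_free (B i).
Proof. by rewrite /row_free mxrankMfree ?GLval_free. Qed.

Lemma block_dim : (m * n.+1)%N = d.+1.
Proof.
apply: etrans Vs_rank; rewrite -[m in LHS]card_ord -sum_nat_const.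
apply: eq_bigr => i _; rewrite -(eqmx_rank (B1g i)).
by apply/esym/eqP; apply: block_base_free.
Qed.

(* The group induced on the row space of [B1] by its stabilizer in [K], written
   in the basis [B1]. *)
Definition block_stab : {set {'GL_n.+1['F_p]}} :=
  [set C : {'GL_n.+1['F_p]} | [exists A in K, B1 *m GLval A == GLval C *m B1]].

Fact block_stab_group_set : group_set block_stab.
Proof.
apply/group_setP; split.
  by rewrite inE; apply/exists_inP; exists 1%g; rewrite ?group1 //= mulmx1 mul1mx.
move=> C C'; rewrite !inE => /exists_inP[A KA /eqP AC] /exists_inP[A' KA' /eqP AC'].
apply/exists_inP; exists (A * A')%g; first exact: groupM.
by rewrite !GLvalM mulmxA AC -!mulmxA AC'.
Qed.
Definition block_stab_group := Group block_stab_group_set.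
Local Notation K1 := block_stab_group.

Lemma block_stabP A : A \in K -> (B1 *m GLval A <= B1)%MS ->
  exists2 C, C \in K1 & B1 *m GLval A = GLval C *m B1.
Proof.
move=> KA /submxP[D BD].
(* [D] has the same rank as [D *m B1], which is [B1 *m GLval A] and so has full row rank. *)
have uD : D \is a GRing.unit.
  change (D \in unitmx); rewrite -row_free_unit /row_free.
  by rewrite -(mxrankMfree D B1free) -BD mxrankMfree ?GLval_free.
exists (FinRing.Unit uD) => //; rewrite inE; apply/exists_inP; exists A => //.
exact/eqP.
Qed.

(** Going from the base block to block [i] by [g i], then by [A], and back by the inverse of
    [g (s i)] stabilizes the base block; [C i] is the matrix induced there. *)
Lemma block_coord A : A \in K ->
  exists2 s, s \in block_perm_group & exists2 C : 'I_m -> {'GL_n.+1['F_p]},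
    forall i, C i \in K1 & forall i, B i *m GLval A = GLval (C i) *m B (s i).
Proof.
move=> KA; have [s Ls sA] := block_permP KA; exists s => //.
have /fin_all_exists[C CE] i : exists C : {'GL_n.+1['F_p]},
    C \in K1 /\ B i *m GLval A = GLval C *m B (s i).
  have Kh : (g i * A * (g (s i))^-1)%g \in K by rewrite groupM ?groupV ?groupM ?Kg.
  have [|C K1C BC] := block_stabP Kh.
    rewrite -(submxMfree _ _ (GLval_free (g (s i)))) -mulmxA -GLvalM mulgKV.
    rewrite GLvalM mulmxA (eqmxMr _ (eqmxP (B1g i))).
    by rewrite (eqmxP (B1g (s i))); case/andP: (sA i).
  by exists C; split=> //; rewrite /B mulmxA -BC -[RHS]mulmxA -GLvalM mulgKV GLvalM mulmxA.
by exists C => i; case: (CE i).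
Qed.

Lemma block_stab_section : (#|K1| %| #|K|)%N /\ (solvable K -> solvable K1).
Proof.
apply: (@section_of_relation _ _ K K1 (fun A C => B1 *m GLval A == GLval C *m B1)).
- by rewrite mulmx1 mul1mx.
- move=> A A' C C' _ _ _ _ /eqP AC /eqP AC'.
  by rewrite !GLvalM mulmxA AC -!mulmxA AC'.
- move=> A C C' _ _ /eqP -> /eqP /(row_free_inj B1free) e.
  exact: val_inj.
- by move=> C; rewrite inE => /exists_inP.
Qed.

(** Copying an invariant [U] into every block gives a subspace invariant under [K]. If it is zero,
    so is [U]; if it is full, comparing [m * n.+1] with [m * \rank U] makes [U] full. *)
Lemma block_stab_irreducible : lin_irreducible K1.
Proof.
move=> U stU; pose S := (\sum_i <<U *m B i>>)%MS.
have rU i : \rank (U *m B i) = \rank U by rewrite mxrankMfree ?block_base_free.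
have [A KA|/eqP S0|fS] := irrK (U := S).
- rewrite sumsmxMr; apply/sumsmx_subP=> i _.
  have [s _ [C K1C CE]] := block_coord KA; apply: (sumsmx_sup (s i)) => //.
  by rewrite (eqmxMr _ (genmxE _)) genmxE -mulmxA CE mulmxA submxMr ?stU ?K1C.
- left; have [i _] := imsetP block_perms_trans.
  move=> _; rewrite -mxrank_eq0 -(rU i) mxrank_eq0 -submx0 -S0.
  by apply: (sumsmx_sup i) => //; rewrite genmxE.
right; have := mxrank_sums_leq predT (fun i => <<U *m B i>>%MS).
rewrite -/S (eqP fS) (eq_bigr (fun=> \rank U)) => [|i _]; last by rewrite genmxE.
rewrite sum_nat_const card_ord -block_dim leq_pmul2l => [leU|].
  by rewrite /row_full eqn_leq rank_leq_row leU.
by rewrite lt0n; apply/eqP=> m0; have := block_dim; rewrite m0.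
Qed.

(** A decomposition permuted by [K1] into [t > 1] summands, copied into every block, would give a
    system of [m * t] blocks, against maximality. *)
Lemma block_stab_primitive :
    (forall (I : finType) (Ws : I -> V), block_system Ws -> (#|I| <= m)%N) ->
  lin_primitive K1.
Proof.
move=> maxV [t [Ws [t1 W0 dW fW stW]]].
pose U (ij : 'I_m * 'I_t) := <<Ws ij.2 *m B ij.1>>%MS.
have rU ij : \rank (U ij) = \rank (Ws ij.2).
  by rewrite genmxE mxrankMfree ?block_base_free.
have m0 : (0 < m)%N.
  by rewrite lt0n; apply/eqP=> m0; have := block_dim; rewrite m0.
suff /maxV : block_system U.
  by rewrite card_prod !card_ord -{2}[m]muln1 leq_pmul2l // leqNgt t1.
apply/block_systemP; split=> [ij||| A KA [i j]].
- by rewrite -mxrank_eq0 rU mxrank_eq0.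
- rewrite (eq_bigr (fun ij => \rank (Ws ij.2))) => [|ij _]; last exact: rU.
  rewrite -(pair_bigA _ (fun (i : 'I_m) j => \rank (Ws j))) /= sum_nat_const card_ord.
  by move/mxdirectP: dW => /= <-; rewrite (eqP fW) block_dim.
- rewrite -sub1mx; apply: submx_trans (_ : (\sum_i Vs i <= _)%MS); first by rewrite sub1mx.
  apply/sumsmx_subP=> i _; rewrite -(eqmxP (B1g i)) -/(B i) -[B i]mul1mx.
  have /sub_sumsmxP[u ->] : (1%:M <= \sum_j Ws j)%MS by rewrite sub1mx.
  rewrite mulmx_suml; apply: summx_sub => j _.
  by apply: (sumsmx_sup (i, j)) => //; rewrite genmxE -mulmxA submxMl.
have [s _ [C K1C CE]] := block_coord KA; have [k jk] := stW _ (K1C i) j.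
exists (s i, k); apply/eqmxP.
apply: eqmx_trans (eqmxMr _ (genmxE _)) _; apply: eqmx_trans (eqmx_sym (genmxE _)).
by rewrite /= -mulmxA CE mulmxA; apply: eqmxMr; apply/eqmxP.
Qed.

Definition block_sum (a : {ffun 'I_m -> 'rV['F_p]_n.+1}) : 'rV['F_p]_d.+1 :=
  \sum_i a i *m B i.

Lemma block_sum_bij : bijective block_sum.
Proof.
have /fin_all_exists[h hK] v : exists a, block_sum a = v.
  have /sub_sumsmxP[u ->] : (v <= \sum_i Vs i)%MS by apply: submx_full.
  have VB i : (u i *m Vs i <= B i)%MS.
    by rewrite (submx_trans (submxMl _ _)) // (eqmxP (B1g i)).
  have /fin_all_exists[a aE] i := submxP (VB i).
  by exists (finfun a); apply: eq_bigr => i _; rewrite ffunE aE.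
(* The blocks span, so [block_sum] has a right inverse [h]. It is injective between sets of equal
   size by [block_dim], hence bijective. *)
have h_bij : bijective h.
  apply: inj_card_bij (can_inj hK) _.
  by rewrite card_ffun !card_mx !mul1n !card_ord -expnM [(n.+1 * m)%N]mulnC block_dim.
by exists h => //; apply/(bij_can_sym h_bij).
Qed.

End Coordinates.
End Blocks.

(** * The affine group of a linear group as a permutation group *)

Section AffineGroup.
Local Open Scope ring_scope.
Variables (p n : nat) (K : {group {'GL_n.+1['F_p]}}).
Local Notation V := 'rV['F_p]_n.+1.

Definition affine_map (A : {'GL_n.+1['F_p]}) (b v : V) : V := v *m GLval A + b.

Fact affine_map_inj A b : injective (affine_map A b).
Proof. by move=> u v /addIr; apply: row_free_inj; apply: GLval_free. Qed.

Definition affine_perm A b : {perm V} := perm (@affine_map_inj A b).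

Lemma affine_permE A b v : affine_perm A b v = v *m GLval A + b.
Proof. by rewrite permE. Qed.

Definition affine_set : {set {perm V}} :=
  [set affine_perm A b | A in K, b in [set: V]].

Lemma affineP s :
  reflect (exists2 A, A \in K & exists b, s = affine_perm A b) (s \in affine_set).
Proof.
apply: (iffP imset2P) => [[A b KA _ ->]|[A KA [b ->]]]; last by exists A b.
by exists A => //; exists b.
Qed.

Fact affine_group_set : group_set affine_set.
Proof.
apply/group_setP; split.
  apply/affineP; exists 1%g => //; exists 0; apply/permP=> v.
  by rewrite affine_permE perm1 mulmx1 addr0.
move=> _ _ /affineP[A KA [b ->]] /affineP[A' KA' [b' ->]].
apply/affineP; exists (A * A')%g; first exact: groupM.
exists (b *m GLval A' + b'); apply/permP=> v.
by rewrite permM !affine_permE GLvalM mulmxDl mulmxA addrA.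
Qed.
Definition affine_group := Group affine_group_set.

Lemma affine_InvE : affine_Inv K = Inv affine_group.
Proof.
apply: eq_imset => x; apply/setP=> y; apply/imset2P/orbitalP.
  case=> A b KA _ ->; exists (affine_perm A b); last by rewrite !affine_permE.
  by apply/affineP; exists A => //; exists b.
case=> _ /affineP[A KA [b ->]] ->; exists A b => //.
by rewrite !affine_permE.
Qed.

Lemma affine_group_trans : [transitive affine_group, on [set: V] | 'P].
Proof.
apply/imsetP; exists 0 => //; apply/setP=> v; rewrite inE; symmetry.
apply/orbitP; exists (affine_perm 1%g v).
  by apply/affineP; exists 1%g => //; exists v.
by rewrite /= /aperm affine_permE mul0mx add0r.
Qed.

(* A swap [v <-> w] by [x |-> x A + b] gives [(v - w) A = w - v], so the odd
   power [A ^ #|K| = 1] negates [v - w]. *)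
Lemma affine_no_swap : prime p -> odd p -> odd #|K| -> no_swap affine_group.
Proof.
move=> p_pr p_odd oddK _ v /affineP[A KA [b ->]].
rewrite !affine_permE; set w := v *m _ + b => ww.
pose u := v - w.
have uA : u *m GLval A = - u.
  have vA : v *m GLval A = w - b by rewrite addrK.
  have wA : w *m GLval A = v - b by rewrite -[X in X - b]ww addrK.
  by rewrite mulmxBl vA wA !opprB addrA subrK.
have uAX k : u *m GLval (A ^+ k)%g = (-1) ^+ k *: u.
  elim: k => [|k IHk]; first by rewrite expr0 scale1r mulmx1.
  by rewrite expgSr GLvalM mulmxA IHk -scalemxAl uA scalerN exprS mulN1r scaleNr.
have := uAX #|K|; rewrite expg_cardG // mulmx1 -signr_odd oddK expr1 scaleN1r.
move/eqP; rewrite -subr_eq0 opprK -mulr2n -scaler_nat scaler_eq0.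
rewrite -(dvdn_pcharf (pchar_Fp p_pr)) dvdn_prime2 //.
case/orP=> [/eqP p2|]; first by rewrite p2 in p_odd.
by rewrite subr_eq0 => /eqP.
Qed.

End AffineGroup.

(** * Embedding into the wreath product, and conclusion *)

Lemma irreducible_wreath_decomposition (p d : nat) (K : {group {'GL_d.+1['F_p]}}) :
    lin_irreducible K ->
  exists n m (K1 : {group {'GL_n.+1['F_p]}}) (L : {group {perm 'I_m}})
         (B : 'I_m -> 'M['F_p]_(n.+1, d.+1)),
    [/\ lin_irreducible K1, lin_primitive K1, #|K1| %| #|K| &
        solvable K -> solvable K1] /\
    [/\ [transitive L, on [set: 'I_m] | 'P], #|L| %| #|K|,
        bijective (fun a : {ffun 'I_m -> 'rV['F_p]_n.+1} => \sum_i a i *m B i)%R &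
        forall A, A \in K -> exists2 s, s \in L &
          exists2 C : 'I_m -> {'GL_n.+1['F_p]}, forall i, C i \in K1 &
            forall i, (B i *m GLval A = GLval (C i) *m B (s i))%R].
Proof.
move=> irrK; have [m [Vs [sysV maxV]]] := max_block_system K.
have trL := block_perms_trans irrK sysV; have [i0 _ _] := imsetP trL.
have [n [B1 [B1free B1V]]] : exists n (B1 : 'M['F_p]_(n.+1, d.+1)),
    row_free B1 /\ (B1 :=: Vs i0)%MS.
  have /block_systemP[/(_ i0) V0 _ _ _] := sysV; rewrite -mxrank_eq0 in V0.
  (* The rank is generalized so that, being nonzero, it can be written as the successor [n.+1] that
     the matrix group requires. *)
  move: (row_base (Vs i0)) (row_base_free (Vs i0)) (eq_row_base (Vs i0)) V0.
  by case: (\rank (Vs i0)) => // n B1; exists n, B1.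
have /fin_all_exists[g gP] i :
    exists A, A \in K /\ (B1 *m GLval A == Vs i)%MS%R.
  have [A KA /eqmxP iA] := block_act_trans irrK sysV i0 i.
  by exists A; split=> //; apply/eqmxP; apply: eqmx_trans (eqmxMr _ B1V) iA.
have Kg i : g i \in K by case: (gP i).
have B1g i : (B1 *m GLval (g i) == Vs i)%MS%R by case: (gP i).
have [cardK1 solK1] := block_stab_section K B1free.
exists n, m, (block_stab_group K B1), (block_perm_group K Vs), (block_base B1 g).
split; split=> //.
- exact: block_stab_irreducible B1g.
- exact: block_stab_primitive B1g maxV.
- exact: block_perms_card.
- exact (block_sum_bij sysV B1free B1g).
- exact: block_coord.
Qed.

Theorem theorem6p1 (T : finType) (G : {group {perm T}}) :
  1 < #|T| ->
  [primitive G, on [set: T] | 'P] -> solvable G ->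
  exists S' : {set {set T * T}},
    fusion S' (Inv G) /\
    exists (Gam : finType) (Y : {set {set Gam * Gam}}) (m : nat) (L : {group {perm 'I_m}}),
      [/\ lin_prim_scheme Y,
          [transitive L, on [set: 'I_m] | 'P],
          cc_iso S' (expo Y L) &
          (cc_antisymmetric (Inv G) -> cc_antisymmetric Y /\ odd #|L|)].
Proof.
move=> T1 primG solG.
have [p [d [K [phi [[p_pr pG KG solK irrK] [[phi' phiK phi'K] phiG]]]]]] :=
  affine_of_primitive T1 primG solG.
have [n [m [K1 [L [B [[irrK1 primK1 K1K solK1] [trL LK [coord sumK coordK] KB]]]]]]] :=
  irreducible_wreath_decomposition irrK.
pose sumB (a : {ffun 'I_m -> 'rV['F_p]_n.+1}) := (\sum_i a i *m B i)%R.
pose f t := coord (phi t); pose fi a := phi' (sumB a).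
have fK : cancel f fi by move=> t; rewrite /fi /f /sumB coordK phiK.
have fiK : cancel fi f by move=> a; rewrite /fi /f phi'K sumK.
pose H := affine_group K1.
have sGW : G \subset wreath H L f.
  apply/subsetP=> g Gg; apply/wreathP; have [A KA [b gE]] := phiG g Gg.
  have [s Ls [C K1C CE]] := KB A KA; exists s => //.
  (* Coordinate [i] of the image comes from block [s^-1 i], hence the index of [C]; the translation
     is split along the blocks. *)
  exists (fun i => affine_perm (C ((s^-1)%g i)) (coord b i)) => [i|t i].
    by apply/affineP; exists (C ((s^-1)%g i)); [apply: K1C | exists (coord b i)].
  rewrite affine_permE.
  pose a := [ffun j => f t ((s^-1)%g j) *m GLval (C ((s^-1)%g j)) + coord b j]%R.
  suff -> : f (g t) = a by rewrite ffunE.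
  apply: (can_inj sumK); rewrite coordK gE -[b in LHS]coordK -[phi t]coordK -/(f t).
  (* Reindexing by [s] the image sum and the translation sum matches source block [j] with its
     target [s j]. *)
  rewrite mulmx_suml [in RHS](reindex_inj (@perm_inj _ s)) /=.
  rewrite [X in (_ + X)%R](reindex_inj (@perm_inj _ s)) /= -big_split /=.
  by apply: eq_bigr => j _; rewrite ffunE permK mulmxDl -!mulmxA CE.
exists (Inv (wreath H L f)); split; first exact: fusion_Inv.
exists 'rV['F_p]_n.+1, (Inv H), m, L; split=> //.
- split; first exact/is_scheme_Inv/affine_group_trans.
  exists p, n, K1; split=> //; first exact: solK1.
  exists id; split; first by exists id.
  rewrite -affine_InvE -[LHS]imset_id; apply: eq_imset => s.
  by rewrite -[LHS]imset_id; apply: eq_imset => -[].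
- exact: cc_iso_wreath fK fiK.
(* The characteristic [p] and the orders of [K1] and [L] all divide the odd order of [G], the last
   two through the order of [K]. *)
move/antisymmetric_InvP/no_swap_odd=> oddG; split; last first.
  exact: dvdn_odd (dvdn_trans LK KG) oddG.
apply/antisymmetric_InvP/affine_no_swap => //; first exact: dvdn_odd pG oddG.
exact: dvdn_odd (dvdn_trans K1K KG) oddG.
Qed.
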